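(* Let $\mathcal{O}\subset\mathbb{R}^4$ be open with coordinates $(u_1,u_2,u_3,u_4)$, and let $a,b,c\in C^\infty(\mathcal{O})$ depend only on $(u_1,u_2)$. Consider the Walker metric $g_{a,b,c}$ whose matrix in the coordinate frame is $$(g_{a,b,c})_{ij}=\begin{pmatrix}0&0&1&0\\0&0&0&1\\1&0&a&c\\0&1&c&b\end{pmatrix}.$$ Then $g_{a,b,c}$ is locally conformally flat if and only if \begin{align*} a&=\tfrac{I}{2}u_1^2+Ju_1+Eu_1u_2+Fu_2+K,\\ b&=-\tfrac{I}{2}u_2^2+Lu_2+Mu_1u_2+Nu_1+R,\\ c&=\tfrac{M}{2}u_1^2+Pu_1+\tfrac{E}{2}u_2^2+Gu_2+(Q+H), \end{align*} where $E,F,G,H,I,J,K,L,M,N,P,Q,R$ are constants satisfying \begin{align*} 0&=EN-JM+IP,\\ 0&=EL-FM+IG,\\ 0&=ER-KM+I(H+Q),\\ 0&=K(LP-NG)+R(JG-FP)+(Q+H)(FN-JL). \end{align*}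
   Context: A pseudo-Riemannian manifold is locally conformally flat if and only if its Weyl conformal curvature tensor vanishes, where for dimension $n$ the Weyl tensor is $W(X,Y,Z,T)=R(X,Y,Z,T)+\frac{Sc}{(n-1)(n-2)}\{g(Y,Z)g(X,T)-g(X,Z)g(Y,T)\}+\frac{1}{n-2}\{\rho(Y,Z)g(X,T)-\rho(X,Z)g(Y,T)-\rho(Y,T)g(X,Z)+\rho(X,T)g(Y,Z)\}$, with $\rho$ the Ricci tensor and $Sc$ the scalar curvature.
   Formalization: The open set is assumed connected (otherwise a, b, c could have different constants on different components, and ''only if'' fails), and the Ricci term of the Weyl tensor carries the sign −1/(n−2) instead of +1/(n−2), as needed for it to be the Weyl tensor. *)

(* Defs.v *)
From HB Require Import structures.
From mathcomp Require Import all_boot all_order all_algebra.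
From mathcomp Require Import all_classical all_reals all_analysis.
Set Implicit Arguments. Unset Strict Implicit. Unset Printing Implicit Defensive.
Import Order.TTheory GRing.Theory Num.Theory numFieldNormedType.Exports.
Local Open Scope classical_set_scope.
Local Open Scope ring_scope.

Section Walker.
Context {R : realType}.

(* points of R^4 with coordinates u_1..u_4 = x 0 0, x 0 1, x 0 2, x 0 3 *)
Definition pt := 'rV[R]_4.

Definition evec (i : 'I_4) : pt := delta_mx 0 i.

Definition pd (i : 'I_4) (f : pt -> R) : pt -> R := fun x => derive f x (evec i).

Definition iter_pd (s : seq 'I_4) (f : pt -> R) : pt -> R := foldr pd f s.

Definition smooth_on (O : set pt) (f : pt -> R) : Prop :=
  forall (s : seq 'I_4) (x : pt), O x -> differentiable (iter_pd s f) x.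

(* a (pseudo-)Riemannian metric on a subset of R^4 given by its components
   g_ij = g(d/du_i, d/du_j) *)
Definition metric := 'I_4 -> 'I_4 -> pt -> R.

Definition gmx (g : metric) (x : pt) : 'M[R]_4 := \matrix_(i, j) g i j x.
Definition ginv (g : metric) (x : pt) : 'M[R]_4 := invmx (gmx g x).

Definition christoffel (g : metric) (k i j : 'I_4) (x : pt) : R :=
  2^-1 * \sum_(l < 4) ginv g x k l *
     (pd i (g j l) x + pd j (g i l) x - pd l (g i j) x).

(* R(d_i, d_j) d_k = \sum_l riem_up l i j k d_l,
   with R(X,Y) = nabla_X nabla_Y - nabla_Y nabla_X - nabla_[X,Y] *)
Definition riem_up (g : metric) (l i j k : 'I_4) (x : pt) : R :=
  pd i (christoffel g l j k) x - pd j (christoffel g l i k) x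
  + \sum_(m < 4) (christoffel g l i m x * christoffel g m j k x
                  - christoffel g l j m x * christoffel g m i k x).

Definition riem (g : metric) (i j k t : 'I_4) (x : pt) : R :=
  \sum_(l < 4) riem_up g l i j k x * g l t x.

Definition ricci (g : metric) (j k : 'I_4) (x : pt) : R :=
  \sum_(i < 4) riem_up g i i j k x.

Definition scal (g : metric) (x : pt) : R :=
  \sum_(i < 4) \sum_(j < 4) ginv g x i j * ricci g i j x.

(* Weyl conformal curvature tensor in dimension n = 4 (consistent with the
   curvature convention above) *)
Definition weyl (g : metric) (i j k t : 'I_4) (x : pt) : R :=
  riem g i j k t x
  + scal g x / ((4 - 1) * (4 - 2))
      * (g j k x * g i t x - g i k x * g j t x)
  - (4 - 2)^-1 *
      (ricci g j k x * g i t x - ricci g i k x * g j t x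
       - ricci g j t x * g i k x + ricci g i t x * g j k x).

(* locally conformally flat on O, characterized (as in the paper's context)
   by the vanishing of the Weyl tensor *)
Definition locally_conformally_flat (O : set pt) (g : metric) : Prop :=
  forall x, O x -> forall i j k t : 'I_4, weyl g i j k t x = 0.

Definition walker (a b c : pt -> R) : metric := fun i j x =>
  match nat_of_ord i, nat_of_ord j return R with
  | 0%N, 2%N | 2%N, 0%N | 1%N, 3%N | 3%N, 1%N => 1
  | 2%N, 2%N => a x
  | 3%N, 3%N => b x
  | 2%N, 3%N | 3%N, 2%N => c x
  | _, _ => 0
  end.

Definition of12 (f : R -> R -> R) : pt -> R := fun x => f (x 0 0) (x 0 1).

End Walker.

(* Main.v *)
Require Import Defs.
From HB Require Import structures.
From mathcomp Require Import all_boot all_order all_algebra.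
From mathcomp Require Import all_classical all_reals all_analysis.
From mathcomp Require Import ring lra.
Import Order.TTheory GRing.Theory Num.Theory numFieldNormedType.Exports.
Local Open Scope classical_set_scope.
Local Open Scope ring_scope.

(** Computing the Weyl tensor of the Walker metric, its vanishing is equivalent to
    the linear system a_22 = b_11 = c_12 = 0, b_22 = - a_11, b_12 = c_11,
    a_12 = c_22, together with b a_12 - a b_12 + c a_11 = 0 and the vanishing of
    the determinant with rows (a, b, c) and its two partial derivatives.
    Differentiating the linear system once more makes all third derivatives zero,
    so on a connected set a, b, c are the stated quadratic polynomials.  The first
    remaining equation is then affine in (u_1, u_2), and its three coefficients are
    the first three algebraic conditions.  These say that (a, b, c) and its
    derivatives are orthogonal to w = (-M, E, I); if w <> 0 the determinant
    vanishes, and if w = 0 then a, b, c are affine, so in both cases the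
    determinant is constant, equal to the fourth condition. *)

Set Implicit Arguments. Unset Strict Implicit.

Local Ltac num_field := by field; rewrite ?pnatr_eq0.

(** * Directional derivatives *)

Section DirectionalDerivatives.
Context {R : realType} {V : normedModType R}.
Implicit Types (f : V -> R) (x v : V).

(** The difference quotient of the restriction to the line is exactly the directional one, which
    makes the one-variable mean value theorem available. *)
Lemma is_derive_line f x v (t : R) : derivable f (x + t *: v) v ->
  is_derive t 1 (fun s : R => f (x + s *: v)) ('D_v f (x + t *: v)).
Proof.
move=> df.
have E : (fun h : R => h^-1 *:
    (((fun s : R => f (x + s *: v)) \o shift t) (h *: (1 : R)) - f (x + t *: v))) =
  (fun h => h^-1 *: ((f \o shift (x + t *: v)) (h *: v) - f (x + t *: v))).
  apply/funext => h /=; congr (_ *: (f _ - _)).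
  by rewrite [h *: 1]mulr1 scalerDl addrCA.
by split; rewrite /derivable /derive E.
Qed.

Lemma MVT_line f x v (h : R) : 0 < h ->
  (forall t, 0 <= t <= h -> derivable f (x + t *: v) v) ->
  exists2 t, 0 < t < h & f (x + h *: v) - f x = h * 'D_v f (x + t *: v).
Proof.
move=> h0 df.
have dl t : 0 <= t <= h ->
    is_derive t 1 (fun s : R => f (x + s *: v)) ('D_v f (x + t *: v)).
  by move=> /df; exact: is_derive_line.
have [||t] := @MVT _ (fun s : R => f (x + s *: v))
    (fun t => 'D_v f (x + t *: v)) 0 h h0.
- by move=> t; rewrite in_itv /= => /andP[t0 th]; apply: dl; rewrite !ltW.
- apply: derivable_within_continuous => t; rewrite in_itv /= => tI.
  by have [] := dl t tI.
- by rewrite in_itv /= scale0r addr0 subr0 mulrC => tI ?; exists t.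
Qed.

(* Two applications of the mean value theorem express the second difference
   through the iterated derivative at an intermediate point. *)
Lemma second_difference f x u v (h : R) : 0 < h ->
  (forall s t, 0 <= s <= h -> 0 <= t <= h ->
     derivable f (x + s *: u + t *: v) u /\
     derivable ('D_u f) (x + s *: u + t *: v) v) ->
  exists s t, [/\ 0 < s < h, 0 < t < h &
    f (x + h *: u + h *: v) - f (x + h *: u) - (f (x + h *: v) - f x) =
    h ^+ 2 * 'D_v ('D_u f) (x + s *: u + t *: v)].
Proof.
move=> h0 df.
have hh : 0 <= h <= h by rewrite lexx ltW.
have h00 : (0 : R) <= 0 <= h by rewrite lexx ltW.
(* The second difference is the increment of [g] along [u]. The mean value theorem is applied to [g]
   along [u], then to the derivative of [f] along [u] in direction [v]. *)
pose g y := f (y + h *: v) - f y.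
have dg s : 0 <= s <= h ->
    derivable g (x + s *: u) u /\
    'D_u g (x + s *: u) = 'D_u f (x + s *: u + h *: v) - 'D_u f (x + s *: u).
  move=> sI.
  have [d1 _] := df s h sI hh; have [d2 _] := df s 0 sI h00.
  rewrite scale0r addr0 in d2.
  have E : (fun k : R => k^-1 *: (((fun y => f (y + h *: v)) \o shift (x + s *: u))
       (k *: u) - f (x + s *: u + h *: v))) =
      (fun k => k^-1 *: ((f \o shift (x + s *: u + h *: v)) (k *: u) -
         f (x + s *: u + h *: v))).
    by apply/funext => k /=; rewrite !addrA.
  have D1 : is_derive (x + s *: u) u (fun y => f (y + h *: v))
      ('D_u f (x + s *: u + h *: v)).
    by split; rewrite /derivable /derive E.
  have D2 := derivableP d2.
  have D : is_derive (x + s *: u) u g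
    ('D_u f (x + s *: u + h *: v) - 'D_u f (x + s *: u)) by exact: is_deriveB.
  by case: D.
have [|s sI] := @MVT_line g x u h h0; first by move=> s /dg[].
have sI' : 0 <= s <= h by case/andP: sI => *; rewrite !ltW.
rewrite /g (dg s sI').2 => ->.
have [t tI ->] := @MVT_line ('D_u f) (x + s *: u) v h h0
  (fun t tI => (df s t sI' tI).2).
by exists s, t; split=> //; rewrite expr2 mulrA.
Qed.

(** Schwarz's theorem. The second difference over a small parallelogram is symmetric in [u] and [v],
    so the two mixed derivatives agree after division by [h ^+ 2], though at different points close
    to [x]; continuity at [x] then makes their values at [x] differ by at most any [e]. *)
Lemma derive_comm f x u v :
  (\forall y \near x, differentiable f y) ->
  (\forall y \near x, derivable ('D_u f) y v) ->
  (\forall y \near x, derivable ('D_v f) y u) ->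
  {for x, continuous ('D_v ('D_u f))} -> {for x, continuous ('D_u ('D_v f))} ->
  'D_v ('D_u f) x = 'D_u ('D_v f) x.
Proof.
move=> df du dv cvu cuv; apply/eqP; rewrite -subr_eq0 -normr_le0.
apply/ler_addgt0Pl => e e0; rewrite addr0.
have e20 : 0 < e / 2 by rewrite divr_gt0.
have /cvgrPdist_lt /(_ _ e20) nvu := cvu.
have /cvgrPdist_lt /(_ _ e20) nuv := cuv.
have /nbhs_ballP[d /= d0 dP] : \forall y \near x,
   [/\ differentiable f y, derivable ('D_u f) y v, derivable ('D_v f) y u,
     `|'D_v ('D_u f) x - 'D_v ('D_u f) y| < e / 2 &
     `|'D_u ('D_v f) x - 'D_u ('D_v f) y| < e / 2].
  have FF : Filter (nbhs x) by exact: nbhs_filter.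
  have I P Q := @filterI _ _ FF P Q.
  apply: (@filterS _ _ FF _ _ _ (I _ _ (I _ _ df (I _ _ du dv)) (I _ _ nvu nuv))) => y.
  by move=> [[a1 [a2 a3]] [a4 a5]]; exact: And5 a1 a2 a3 a4 a5.
(* This size keeps the whole parallelogram inside the ball of radius [d]; the summand 1 makes the
   denominator positive even for [u = v = 0]. *)
pose h := d / (`|u| + `|v| + 1).
have N0 : 0 < `|u| + `|v| + 1 by rewrite ltr_wpDl// addr_ge0.
have h0 : 0 < h by rewrite divr_gt0.
have inb s t : 0 <= s <= h -> 0 <= t <= h -> ball x d (x + s *: u + t *: v).
  move=> /andP[s0 sh] /andP[t0 th].
  rewrite -ball_normE /= -addrA opprD addNKr normrN.
  apply: (le_lt_trans (ler_normD _ _)); rewrite !normrZ !ger0_norm//.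
  apply: (@le_lt_trans _ _ (h * (`|u| + `|v|))).
    by rewrite mulrDr lerD// ler_wpM2r.
  rewrite /h mulrAC ltr_pdivrMr// ltr_pM2l// ltrDl.
  exact: ltr01.
have inb' s t : 0 <= s <= h -> 0 <= t <= h -> ball x d (x + t *: v + s *: u).
  by move=> ? ?; rewrite addrAC; exact: inb.
have [|s [t [sI tI E]]] := @second_difference f x u v h h0.
  move=> s t sI tI; have [d1 d2 _ _ _] := dP _ (inb s t sI tI).
  exact: conj (diff_derivable d1) d2.
have [|t' [s' [tI' sI' E']]] := @second_difference f x v u h h0.
  move=> t' s' tI' sI'; have [d1 _ d2 _ _] := dP _ (inb' s' t' sI' tI').
  exact: conj (diff_derivable d1) d2.
have swap (p q r w : R) : p - q - (r - w) = p - r - (q - w) by ring.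
have EE : 'D_v ('D_u f) (x + s *: u + t *: v) = 'D_u ('D_v f) (x + t' *: v + s' *: u).
  apply: (@mulfI _ (h ^+ 2)); first by rewrite expf_neq0// gt_eqF.
  apply: etrans (esym E) _; apply: etrans E'.
  by rewrite (addrAC x (h *: u)); exact: swap.
have W (r : R) : 0 < r < h -> 0 <= r <= h by case/andP => *; rewrite !ltW.
have [_ _ _ H1 _] := dP _ (inb s t (W _ sI) (W _ tI)).
have [_ _ _ _ H2] := dP _ (inb' s' t' (W _ sI') (W _ tI')).
rewrite EE in H1.
have tri (p q r : R) : `|p - r| < e / 2 -> `|q - r| < e / 2 -> `|p - q| <= e.
  move=> pr qr; have -> : p - q = (p - r) - (q - r) by ring.
  apply: (le_trans (ler_normB _ _)); rewrite [leRHS]splitr; exact: ltW (ltrD pr qr).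
exact: tri H1 H2.
Qed.

(** On a ball inside [O] the mean value theorem along segments makes [f] constant, so a level set of
    [f] is both open and closed relative to [O]. *)
Lemma diff0_cst (O : set V) f : open O -> connected O ->
  (forall x, O x -> differentiable f x) ->
  (forall x v, O x -> 'D_v f x = 0) ->
  forall x y, O x -> O y -> f x = f y.
Proof.
move=> oO cO df f0.
have loc x : O x -> \forall y \near x, O y /\ f y = f x.
  move=> Ox; have /nbhs_ballP[d /= d0 dP] : nbhs x O by exact: open_nbhs_nbhs.
  apply/nbhs_ballP; exists d => //= y xy; split; first exact: dP.
  have seg t : 0 <= t <= 1 -> O (x + t *: (y - x)).
    move=> /andP[t0 t1]; apply: dP; move: xy; rewrite -!ball_normE /=.
    rewrite opprD addNKr normrN normrZ (ger0_norm t0) distrC.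
    by apply: le_lt_trans; rewrite ler_piMl.
  have [|t tI] := @MVT_line f x (y - x) 1 ltr01.
    by move=> t /seg Ot; apply: diff_derivable; exact: df.
  rewrite f0; last by apply: seg; case/andP: tI => *; rewrite !ltW.
  by rewrite mulr0 scale1r subrKC => /subr0_eq.
move=> x y Ox Oy.
have E : [set z | O z /\ f z = f x] = O.
  apply: cO; first by exists x.
  - exists [set z | O z /\ f z = f x]; last by apply/seteqP; split=> z /=; tauto.
    rewrite openE => z [Oz fz]; rewrite /interior.
    by near=> w; rewrite /= -fz; near: w; exact: loc.
  (* Relative closedness: the points of [O] with another value also form an open set. *)
  - exists (~` [set z | O z /\ f z <> f x]).
      apply: open_closedC; rewrite openE => z [Oz fz]; rewrite /interior.
      have := loc z Oz; apply: filterS => w [Ow fw] /=.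
      by rewrite fw.
    apply/seteqP; split=> z /=; first tauto.
    by move=> [Oz nz]; split => //; apply: contrapT => fz; apply: nz.
by have : [set z | O z /\ f z = f x] y by [rewrite E]; case.
Unshelve. all: by end_near. Qed.

End DirectionalDerivatives.

(** * Partial derivatives and quadratic polynomials *)

Section PartialDerivatives.
Context {R : realType}.
Notation pt := (@pt R).
Implicit Types (O : set pt) (f g : pt -> R) (x : pt).

Lemma smooth_pd O f i : smooth_on O f -> smooth_on O (pd i f).
Proof. by move=> sf s x Ox; have := sf (rcons s i) x Ox; rewrite /iter_pd foldr_rcons. Qed.

Lemma smooth_differentiable O f x : smooth_on O f -> O x -> differentiable f x.
Proof. by move=> sf Ox; exact: (sf [::] x Ox). Qed.

Lemma pd_congr O f g i : open O -> (forall x, O x -> f x = g x) ->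
  forall x, O x -> pd i f x = pd i g x.
Proof.
move=> oO fg x Ox; apply: near_eq_derive.
have N : nbhs x O by exact: open_nbhs_nbhs.
by apply: filterS N => y /fg.
Qed.

Lemma pdC O f i j x : open O -> smooth_on O f -> O x ->
  pd i (pd j f) x = pd j (pd i f) x.
Proof.
move=> oO sf Ox; have N : nbhs x O by exact: open_nbhs_nbhs.
apply: derive_comm.
- by apply: filterS N => y; exact: smooth_differentiable.
- apply: filterS N => y Oy; apply: diff_derivable.
  exact: smooth_differentiable (smooth_pd j sf) Oy.
- apply: filterS N => y Oy; apply: diff_derivable.
  exact: smooth_differentiable (smooth_pd i sf) Oy.
- apply: differentiable_continuous.
  exact: smooth_differentiable (smooth_pd i (smooth_pd j sf)) Ox.
- apply: differentiable_continuous.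
  exact: smooth_differentiable (smooth_pd j (smooth_pd i sf)) Ox.
Qed.

Lemma derive_pd f x (v : pt) : differentiable f x ->
  'D_v f x = \sum_i v 0 i * pd i f x.
Proof.
move=> df; rewrite deriveE// {1}(row_sum_delta v) linear_sum.
by apply: eq_bigr => i _; rewrite linearZ /pd deriveE.
Qed.

Lemma pd_eq_cst O f g : open O -> connected O ->
  (forall x, O x -> differentiable f x) ->
  (forall x, O x -> differentiable g x) ->
  (forall x i, O x -> pd i f x = pd i g x) ->
  exists k, forall x, O x -> f x = g x + k.
Proof.
move=> oO cO df dg fg.
have [-> | /set0P [x0 Ox0]] := eqVneq O set0; first by exists 0 => x.
exists (f x0 - g x0) => x Ox.
have dh y : O y -> differentiable (f - g) y.
  by move=> Oy; apply: differentiableB; [exact: df|exact: dg].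
have h0 y v : O y -> 'D_v (f - g) y = 0.
  move=> Oy; rewrite deriveB; [|exact/diff_derivable/df|exact/diff_derivable/dg].
  rewrite !derive_pd; [|exact: dg|exact: df].
  by rewrite -sumrB big1// => i _; rewrite fg// subrr.
have : (f - g) x = (f - g) x0 by exact: (diff0_cst oO cO dh h0).
by rewrite !fctE => <-; rewrite subrKC.
Qed.

(** Dependence on [(u_1, u_2)] alone is stated as translation invariance because this form passes to
    partial derivatives: the difference quotients are the same. *)
Definition ignores34 f := forall x (i : 'I_4) t, (1 < i)%N ->
  f (x + t *: evec i) = f x.

Lemma ignores34_of12 (a : R -> R -> R) : ignores34 (of12 a).
Proof.
move=> x i t i1; rewrite /of12 !mxE.
by case: i i1 => [[|[|[|[|]]]] ?]//= _; rewrite !mulr0 !addr0.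
Qed.

Lemma ignores34_pd f j : ignores34 f -> ignores34 (pd j f).
Proof.
move=> ff x i t i1; rewrite /pd /derive.
rewrite (_ : (fun h => _) =
  (fun h => h^-1 *: ((f \o shift x) (h *: evec j) - f x)))//.
by apply/funext => h /=; rewrite addrA !ff.
Qed.

Lemma pd34 f (i : 'I_4) x : ignores34 f -> (1 < i)%N -> pd i f x = 0.
Proof.
move=> ff i1; rewrite /pd /derive.
rewrite (_ : (fun h => _) = cst 0); first exact: lim_cst.
by apply/funext => h /=; rewrite (addrC _ x) ff// subrr scaler0.
Qed.

Lemma pd_cst i (k : R) x : pd i (fun=> k) x = 0.
Proof. exact: derive_cst. Qed.

(** The halves make [p], [q], [r] the second derivatives 11, 12 and 22. With [p = q = r = 0] the
    function is affine, so the family contains its own derivatives. *)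
Definition quad (p q r s t k : R) : pt -> R := fun x =>
  p / 2 * x 0 0 ^+ 2 + q * (x 0 0 * x 0 1) + r / 2 * x 0 1 ^+ 2
  + s * x 0 0 + t * x 0 1 + k.

Lemma is_derive_coord i x (j : 'I_4) :
  is_derive x (evec i) (fun y : pt => y 0 j : R) (i == j)%:R.
Proof.
split; first exact/diff_derivable/differentiable_coord.
rewrite /derive; apply/cvg_lim => //.
apply: cvg_near_cst; near=> h.
rewrite /= !mxE addrK eqxx /= eq_sym /GRing.scale /= mulKf//.
by near: h; exact: nbhs_dnbhs_neq.
Unshelve. all: by end_near. Qed.

Lemma is_derive_quad p q r s t k i x :
  is_derive x (evec i) (quad p q r s t k)
    (quad 0 0 0 p q s x * (i == 0)%:R + quad 0 0 0 q r t x * (i == 1)%:R).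
Proof.
have d0 := is_derive_coord i x 0; have d1 := is_derive_coord i x 1.
set u := (fun y : pt => y 0 0 : R) in d0; set v := (fun y : pt => y 0 1 : R) in d1.
have -> : quad p q r s t k = cst (p / 2) * u ^+ 2 + cst q * (u * v) +
   cst (r / 2) * v ^+ 2 + cst s * u + cst t * v + cst k.
  by apply/funext => y; rewrite /quad /= /u /v.
have dM (c : R) f df : is_derive x (evec i) f df ->
    is_derive x (evec i) (cst c * f) (f x * 0 + c * df).
  move=> H; apply: is_derive_eq (is_deriveM (is_derive_cst c x (evec i)) H) _.
  by rewrite addrC.
apply: is_derive_eq (is_deriveD (is_deriveD (is_deriveD (is_deriveD (is_deriveD
  (dM (p / 2) _ _ (is_deriveX 2 d0)) (dM q _ _ (is_deriveM d0 d1)))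
  (dM (r / 2) _ _ (is_deriveX 2 d1))) (dM s _ _ d0)) (dM t _ _ d1))
  (is_derive_cst k x (evec i))) _.
rewrite /quad /GRing.scale /= /u /v.
set z := x 0 0; set w := x 0 1; set b0 := (i == 0)%:R; set b1 := (i == 1)%:R.

by num_field.
Qed.

Lemma differentiable_quad p q r s t k x : differentiable (quad p q r s t k) x.
Proof.
have d j : differentiable (fun y : pt => y 0 j : R) x by exact: differentiable_coord.
set u := (fun y : pt => y 0 0 : R); set v := (fun y : pt => y 0 1 : R).
have du : differentiable u x by exact: d.
have dv : differentiable v x by exact: d.
have -> : quad p q r s t k = cst (p / 2) * u ^+ 2 + cst q * (u * v) +
   cst (r / 2) * v ^+ 2 + cst s * u + cst t * v + cst k.
  by apply/funext => y; rewrite /quad /= /u /v.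
have dM (c : R) f : differentiable f x -> differentiable (cst c * f) x.
  by move=> H; exact: differentiableM (differentiable_cst c x) H.
have du2 : differentiable (u ^+ 2) x by exact: differentiableX.
have dv2 : differentiable (v ^+ 2) x by exact: differentiableX.
have duv : differentiable (u * v) x by exact: differentiableM.
apply: differentiableD (differentiable_cst k x).
by do 4![apply: differentiableD; last by exact: dM]; exact: dM.
Qed.

Lemma pd_quad0 p q r s t k : pd 0 (quad p q r s t k) = quad 0 0 0 p q s.
Proof.
apply/funext => x; rewrite /pd; have [_ ->] := is_derive_quad p q r s t k 0 x.
by rewrite /= mulr1 mulr0 addr0.
Qed.

Lemma pd_quad1 p q r s t k : pd 1 (quad p q r s t k) = quad 0 0 0 q r t.
Proof.
apply/funext => x; rewrite /pd; have [_ ->] := is_derive_quad p q r s t k 1 x.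
by rewrite /= mulr1 mulr0 add0r.
Qed.

Lemma ignores34_quad p q r s t k : ignores34 (quad p q r s t k).
Proof. exact: (ignores34_of12 (fun u v => p / 2 * u ^+ 2 + q * (u * v) + r / 2 * v ^+ 2
  + s * u + t * v + k)). Qed.

Lemma gradient_eq_cst O f g : open O -> connected O ->
  (forall x, O x -> differentiable f x) ->
  (forall x, O x -> differentiable g x) ->
  ignores34 f -> ignores34 g ->
  (forall x, O x -> pd 0 f x = pd 0 g x) ->
  (forall x, O x -> pd 1 f x = pd 1 g x) ->
  exists k, forall x, O x -> f x = g x + k.
Proof.
move=> oO cO df dg ff fg E0 E1; apply: pd_eq_cst => // x i Ox.
have [i1|] := ltnP 1 i; first by rewrite !pd34.
case: i => [[|[|]]//= lt] _.
  by rewrite (_ : Ordinal lt = 0); [exact: E0|exact: val_inj].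
by rewrite (_ : Ordinal lt = 1); [exact: E1|exact: val_inj].
Qed.

(** Two integrations: each first derivative has a constant gradient and so is affine, after which
    [f] itself has the gradient of a [quad]. The three integration constants are [s], [t], [k]. *)
Lemma hessian_cst_quad O f p q r : open O -> connected O -> smooth_on O f ->
  ignores34 f ->
  (forall x, O x -> pd 0 (pd 0 f) x = p) ->
  (forall x, O x -> pd 1 (pd 0 f) x = q) ->
  (forall x, O x -> pd 1 (pd 1 f) x = r) ->
  exists s t k, forall x, O x -> f x = quad p q r s t k x.
Proof.
move=> oO cO sf ff h00 h10 h11.
have dq p' q' r' s' t' k' x : O x -> differentiable (quad p' q' r' s' t' k') x.
  by move=> _; exact: differentiable_quad.
have df i x : O x -> differentiable (pd i f) x.
  by move=> Ox; exact: smooth_differentiable (smooth_pd i sf) Ox.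
have E k x : quad 0 0 0 0 0 k x = k by rewrite /quad; num_field.
have [||s H0] := gradient_eq_cst oO cO (df 0) (dq 0 0 0 p q 0)
    (ignores34_pd 0 ff) (@ignores34_quad _ _ _ _ _ _).
- by move=> x Ox; rewrite pd_quad0 E h00.
- by move=> x Ox; rewrite pd_quad1 E h10.
have [||t H1] := gradient_eq_cst oO cO (df 1) (dq 0 0 0 q r 0)
    (ignores34_pd 1 ff) (@ignores34_quad _ _ _ _ _ _).
- by move=> x Ox; rewrite pd_quad0 E (pdC _ _ oO sf Ox) h10.
- by move=> x Ox; rewrite pd_quad1 E h11.
have [|||k H] := gradient_eq_cst oO cO _ (dq p q r s t 0) ff
    (@ignores34_quad _ _ _ _ _ _).
- by move=> x Ox; exact: smooth_differentiable sf Ox.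
- by move=> x Ox; rewrite pd_quad0 H0// /quad; num_field.
- by move=> x Ox; rewrite pd_quad1 H1// /quad; num_field.
by exists s, t, k => x Ox; rewrite H// /quad addr0.
Qed.

End PartialDerivatives.

(** * Curvature of the Walker metric *)

Local Notation o0 := (@Ordinal 4 0 isT).
Local Notation o1 := (@Ordinal 4 1 isT).
Local Notation o2 := (@Ordinal 4 2 isT).
Local Notation o3 := (@Ordinal 4 3 isT).

Lemma sum4 (A : zmodType) (F : 'I_4 -> A) :
  \sum_(l < 4) F l = F o0 + F o1 + F o2 + F o3.
Proof.
rewrite !big_ord_recl big_ord0 addr0 !addrA.
by congr (F _ + F _ + F _ + F _); exact: val_inj.
Qed.

(** Case analysis into literal ordinals, on which matches over the underlying naturals compute. *)
Lemma ord4P (P : 'I_4 -> Prop) : P o0 -> P o1 -> P o2 -> P o3 -> forall i, P i.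
Proof.
move=> P0 P1 P2 P3 [[|[|[|[|//]]]] lt].
- by rewrite (_ : Ordinal lt = o0)//; exact: val_inj.
- by rewrite (_ : Ordinal lt = o1)//; exact: val_inj.
- by rewrite (_ : Ordinal lt = o2)//; exact: val_inj.
- by rewrite (_ : Ordinal lt = o3)//; exact: val_inj.
Qed.

Lemma pd_christoffel (R : realType) (g : @metric R) k i j m x :
  (forall l, differentiable (fun y => ginv g y k l) x) ->
  (forall p q r, differentiable (pd p (g q r)) x) ->
  pd m (christoffel g k i j) x = 2^-1 * \sum_(l < 4)
    (pd m (fun y => ginv g y k l) x *
       (pd i (g j l) x + pd j (g i l) x - pd l (g i j) x)
     + ginv g x k l * (pd m (pd i (g j l)) x + pd m (pd j (g i l)) x
                       - pd m (pd l (g i j)) x)).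
Proof.
move=> dgi dg.
have d2 p q r : is_derive x (evec m) (pd p (g q r)) (pd m (pd p (g q r)) x).
  by apply: derivableP; exact: diff_derivable.
have di l : is_derive x (evec m) (fun y => ginv g y k l)
    (pd m (fun y => ginv g y k l) x).
  by apply: derivableP; exact: diff_derivable.
pose h (l : 'I_4) := (fun y => ginv g y k l) *
  (pd i (g j l) + pd j (g i l) - pd l (g i j)).
have -> : christoffel g k i j = 2^-1 *: \sum_(l < 4) h l.
  apply/funext => y; rewrite /christoffel fctE; congr (_ * _).
  by rewrite fct_sumE.
have dh l : is_derive x (evec m) (h l) _ :=
  is_deriveM (di l) (is_deriveB (is_deriveD (d2 i j l) (d2 j i l)) (d2 l i j)).
rewrite {1}/pd; have [_ ->] := is_deriveZ (2^-1) (is_derive_sum dh).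
congr (_ * _); apply: eq_bigr => l _.
by rewrite /GRing.scale /= addrC mulrC.
Qed.

(** * Closed forms of the Christoffel symbols *)

Section ChristoffelTable.
Context {R : realType}.

(** The constant entries are a parameter: [e = 1] gives the metric, while [e = 0] with derivatives
    in place of [a], [b], [c] gives the derivatives of its entries. *)
Definition walkM (a b c e : R) (i j : nat) : R :=
  match i, j with
  | 0, 2 | 2, 0 | 1, 3 | 3, 1 => e
  | 2, 2 => a
  | 3, 3 => b
  | 2, 3 | 3, 2 => c
  | _, _ => 0%R
  end%N.

(** For [e = 1] this is the inverse metric. It is linear in [(a, b, c, e)], so [e = 0] again
    describes derivatives. *)
Definition invM (a b c e : R) (i j : nat) : R :=
  match i, j with
  | 0, 2 | 2, 0 | 1, 3 | 3, 1 => e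
  | 0, 0 => (- a)%R
  | 1, 1 => (- b)%R
  | 0, 1 | 1, 0 => (- c)%R
  | _, _ => 0%R
  end%N.

(* The Christoffel symbols of the Walker metric are the case [e = 1]. They are
   bilinear in [(a, b, c, e)] and the first derivatives, so that their
   derivative is a sum of two values of [chrT]. *)
Definition chrT (a b c e a1 a2 b1 b2 c1 c2 : R) (k i j : nat) : R :=
  match k, minn i j, maxn i j with
  | 0, 0, 2 => (e * a1 / 2)%R
  | 0, 0, 3 => (e * c1 / 2)%R
  | 0, 1, 2 => (e * a2 / 2)%R
  | 0, 1, 3 => (e * c2 / 2)%R
  | 0, 2, 2 => ((a * a1 + c * a2) / 2)%R
  | 0, 2, 3 => ((a * c1 + c * c2) / 2)%R
  | 0, 3, 3 => ((a * b1 + c * b2) / 2)%R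
  | 1, 0, 2 => (e * c1 / 2)%R
  | 1, 0, 3 => (e * b1 / 2)%R
  | 1, 1, 2 => (e * c2 / 2)%R
  | 1, 1, 3 => (e * b2 / 2)%R
  | 1, 2, 2 => ((c * a1 + b * a2) / 2)%R
  | 1, 2, 3 => ((b * c2 + c * c1) / 2)%R
  | 1, 3, 3 => ((b * b2 + c * b1) / 2)%R
  | 2, 2, 2 => (- (e * a1) / 2)%R
  | 2, 2, 3 => (- (e * c1) / 2)%R
  | 2, 3, 3 => (- (e * b1) / 2)%R
  | 3, 2, 2 => (- (e * a2) / 2)%R
  | 3, 2, 3 => (- (e * c2) / 2)%R
  | 3, 3, 3 => (- (e * b2) / 2)%R
  | _, _, _ => 0%R
  end%N.

Definition partial (f1 f2 : R) (i : nat) : R :=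
  match i with 0 => f1 | 1 => f2 | _ => 0%R end%N.

(** Inverse metric and metric derivatives are independent arguments, so that a single identity
    serves both summands of the product rule. *)
Definition chrF (gi : 'I_4 -> 'I_4 -> R) (dg : 'I_4 -> 'I_4 -> 'I_4 -> R)
    (k i j : 'I_4) :=
  2^-1 * \sum_(l < 4) gi k l * (dg i j l + dg j i l - dg l i j).

Lemma chrFE (a b c e a1 a2 b1 b2 c1 c2 : R) (k i j : 'I_4) :
  chrF (fun p q => invM a b c e p q)
       (fun p => walkM (partial a1 a2 p) (partial b1 b2 p) (partial c1 c2 p) 0)
    k i j = chrT a b c e a1 a2 b1 b2 c1 c2 k i j.
Proof.
rewrite /chrF sum4; move: k i j.
by do 3![apply: ord4P]; rewrite /chrT /=; num_field.
Qed.

End ChristoffelTable.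

(** * Derivatives of the Walker metric and of its Christoffel symbols *)

Section WalkerJets.
Context {R : realType}.
Variables (O : set (@pt R)) (a b c : @pt R -> R).
Hypotheses (oO : open O) (ia : ignores34 a) (ib : ignores34 b) (ic : ignores34 c).
Hypotheses (sa : smooth_on O a) (sb : smooth_on O b) (sc : smooth_on O c).
Notation W := (walker a b c).

Lemma walkerE i j x : W i j x = walkM (a x) (b x) (c x) 1 i j.
Proof. by []. Qed.

Lemma pd_cst_fun i (k : R) : @pd R i (fun=> k) = fun=> 0.
Proof. by apply/funext => x; exact: pd_cst. Qed.

Lemma pd_walker i (j l : 'I_4) :
  pd i (W j l) = fun x => walkM (pd i a x) (pd i b x) (pd i c x) 0 j l.
Proof.
by move: j l; do 2![apply: ord4P]; rewrite /= /walker /= ?pd_cst_fun.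
Qed.

Lemma pd_pd_walker m i (j l : 'I_4) : pd m (pd i (W j l)) =
  fun x => walkM (pd m (pd i a) x) (pd m (pd i b) x) (pd m (pd i c) x) 0 j l.
Proof.
rewrite pd_walker; move: j l.
by do 2![apply: ord4P]; rewrite /= ?pd_cst_fun.
Qed.

Lemma ginv_walker x (i j : 'I_4) : ginv W x i j = invM (a x) (b x) (c x) 1 i j.
Proof.
pose B := \matrix_(p < 4, q < 4) invM (a x) (b x) (c x) 1 p q.
have GB : gmx W x *m B = 1%:M.
  apply/matrixP => p q; rewrite !mxE sum4 !mxE !walkerE.
  by move: p q; do 2![apply: ord4P]; rewrite /=; ring.
have uG : gmx W x \in unitmx by case: (mulmx1_unit GB).
by rewrite /ginv -[invmx _]mulmx1 -GB mulKmx// mxE.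
Qed.

Lemma pd_ginv_walker m x (i j : 'I_4) : O x ->
  pd m (fun y => ginv W y i j) x = invM (pd m a x) (pd m b x) (pd m c x) 0 i j.
Proof.
move=> Ox; rewrite (_ : (fun y => _) = fun y => invM (a y) (b y) (c y) 1 i j); last first.
  by apply/funext => y; exact: ginv_walker.
have dN f : smooth_on O f -> pd m (fun y => - f y) x = - pd m f x.
  move=> sf; rewrite /pd -[LHS]/('D_(evec m) (- f) x) deriveN//.
  exact: diff_derivable (smooth_differentiable sf Ox).
by move: i j; do 2![apply: ord4P]; rewrite /= ?pd_cst ?dN.
Qed.

Lemma pd_partial i (f : @pt R -> R) x : ignores34 f ->
  pd i f x = partial (pd 0 f x) (pd 1 f x) i.
Proof.
move=> ff; move: i; apply: ord4P; [| |exact: pd34|exact: pd34].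
  by rewrite (_ : o0 = 0); last exact: val_inj.
by rewrite (_ : o1 = 1); last exact: val_inj.
Qed.

(** Commuting derivatives writes both mixed derivatives as [pd 1 (pd 0 f)], so three numbers
    describe the Hessian. *)
Lemma pd_pd_partial m i (f : @pt R -> R) x : smooth_on O f -> O x -> ignores34 f ->
  pd m (pd i f) x = partial
    (partial (pd 0 (pd 0 f) x) (pd 1 (pd 0 f) x) m)
    (partial (pd 1 (pd 0 f) x) (pd 1 (pd 1 f) x) m) i.
Proof.
move=> sf Ox ff.
have -> : pd i f = fun y => partial (pd 0 f y) (pd 1 f y) i.
  by apply/funext => y; exact: pd_partial.
have E0 := pd_partial m x (ignores34_pd 0 ff).
have := pd_partial m x (ignores34_pd 1 ff); rewrite (pdC 0 1 oO sf Ox) => E1.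
by move: i; apply: ord4P; [exact: E0|exact: E1|exact: pd_cst|exact: pd_cst].
Qed.

Lemma pd_walker_partial i (j l : 'I_4) x : pd i (W j l) x =
  walkM (partial (pd 0 a x) (pd 1 a x) i) (partial (pd 0 b x) (pd 1 b x) i)
        (partial (pd 0 c x) (pd 1 c x) i) 0 j l.
Proof. by rewrite pd_walker; congr walkM; exact: pd_partial. Qed.

Lemma pd_pd_walker_partial m i (j l : 'I_4) x : O x -> pd m (pd i (W j l)) x =
  walkM (partial (partial (pd 0 (pd 0 a) x) (pd 1 (pd 0 a) x) m)
                 (partial (pd 1 (pd 0 a) x) (pd 1 (pd 1 a) x) m) i)
        (partial (partial (pd 0 (pd 0 b) x) (pd 1 (pd 0 b) x) m)
                 (partial (pd 1 (pd 0 b) x) (pd 1 (pd 1 b) x) m) i)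
        (partial (partial (pd 0 (pd 0 c) x) (pd 1 (pd 0 c) x) m)
                 (partial (pd 1 (pd 0 c) x) (pd 1 (pd 1 c) x) m) i) 0 j l.
Proof. by move=> Ox; rewrite pd_pd_walker; congr walkM; exact: pd_pd_partial. Qed.

Lemma christoffel_walker k i j x : christoffel W k i j x =
  chrT (a x) (b x) (c x) 1 (pd 0 a x) (pd 1 a x) (pd 0 b x) (pd 1 b x)
       (pd 0 c x) (pd 1 c x) k i j.
Proof.
rewrite -chrFE /christoffel /chrF; congr (_ * _); apply: eq_bigr => l _.
by rewrite ginv_walker !pd_walker_partial.
Qed.

(** Product rule: the first summand differentiates the inverse metric ([e = 0]), the second the
    first derivatives of the metric ([e = 1]). *)
Lemma pd_christoffel_walker m k i j x : O x -> pd m (christoffel W k i j) x =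
  chrT (partial (pd 0 a x) (pd 1 a x) m) (partial (pd 0 b x) (pd 1 b x) m)
       (partial (pd 0 c x) (pd 1 c x) m) 0
       (pd 0 a x) (pd 1 a x) (pd 0 b x) (pd 1 b x) (pd 0 c x) (pd 1 c x) k i j
  + chrT (a x) (b x) (c x) 1
      (partial (pd 0 (pd 0 a) x) (pd 1 (pd 0 a) x) m)
      (partial (pd 1 (pd 0 a) x) (pd 1 (pd 1 a) x) m)
      (partial (pd 0 (pd 0 b) x) (pd 1 (pd 0 b) x) m)
      (partial (pd 1 (pd 0 b) x) (pd 1 (pd 1 b) x) m)
      (partial (pd 0 (pd 0 c) x) (pd 1 (pd 0 c) x) m)
      (partial (pd 1 (pd 0 c) x) (pd 1 (pd 1 c) x) m) k i j.
Proof.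
move=> Ox; have d f : smooth_on O f -> differentiable f x.
  by move=> sf; exact: smooth_differentiable sf Ox.
have dN f : smooth_on O f -> differentiable (fun y => - f y) x.
  by move=> /d df; exact: (differentiableN df).
rewrite pd_christoffel.
- rewrite -!chrFE /chrF -mulrDr -big_split; congr (_ * _).
  apply: eq_bigr => l _.
  congr (_ * _ + _ * _).
  + by rewrite pd_ginv_walker//; congr invM; exact: pd_partial.
  + by rewrite !pd_walker_partial.
  + exact: ginv_walker.
  + by congr (_ + _ - _); exact: pd_pd_walker_partial.
- move=> l; rewrite (_ : (fun y => _) = fun y => invM (a y) (b y) (c y) 1 k l); last first.
    by apply/funext => y; exact: ginv_walker.
  move: k l; do 2![apply: ord4P]; rewrite /=; do ?[exact: differentiable_cst];
  exact: dN.
- move=> p q r; rewrite pd_walker.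
  by move: q r; do 2![apply: ord4P]; rewrite /=; do ?[exact: differentiable_cst];
  apply: d; exact: smooth_pd.
Qed.

End WalkerJets.

(** * The Weyl tensor as a function of 2-jets *)

Section CurvatureTable.
Context {R : realType}.

Record jet := Jet { j0 : R; j1 : R; j2 : R; j11 : R; j12 : R; j22 : R }.

Definition jet_at (f : @pt R -> R) x := Jet (f x) (pd 0 f x) (pd 1 f x)
  (pd 0 (pd 0 f) x) (pd 1 (pd 0 f) x) (pd 1 (pd 1 f) x).

(* Copies over [nat] of the curvature definitions, in terms of the 2-jets of
   [a], [b], [c], so that each component reduces to a polynomial. *)
Definition sumT (F : nat -> R) := F 0%N + F 1%N + F 2%N + F 3%N.

Section Tables.
Variables A B C : jet.

Definition gT := walkM (j0 A) (j0 B) (j0 C) 1.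
Definition ginvT := invM (j0 A) (j0 B) (j0 C) 1.
Definition chrisT := chrT (j0 A) (j0 B) (j0 C) 1
  (j1 A) (j2 A) (j1 B) (j2 B) (j1 C) (j2 C).
Definition dchrisT m k i j :=
  chrT (partial (j1 A) (j2 A) m) (partial (j1 B) (j2 B) m)
       (partial (j1 C) (j2 C) m) 0
       (j1 A) (j2 A) (j1 B) (j2 B) (j1 C) (j2 C) k i j
  + chrT (j0 A) (j0 B) (j0 C) 1
       (partial (j11 A) (j12 A) m) (partial (j12 A) (j22 A) m)
       (partial (j11 B) (j12 B) m) (partial (j12 B) (j22 B) m)
       (partial (j11 C) (j12 C) m) (partial (j12 C) (j22 C) m) k i j.
Definition riem_upT l i j k := dchrisT i l j k - dchrisT j l i k
  + sumT (fun m => chrisT l i m * chrisT m j k - chrisT l j m * chrisT m i k).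
Definition riemT i j k t := sumT (fun l => riem_upT l i j k * gT l t).
Definition ricciT j k := sumT (fun i => riem_upT i i j k).
Definition scalT := sumT (fun i => sumT (fun j => ginvT i j * ricciT i j)).
Definition weylT i j k t := riemT i j k t
  + scalT / ((4 - 1) * (4 - 2)) * (gT j k * gT i t - gT i k * gT j t)
  - (4 - 2)^-1 * (ricciT j k * gT i t - ricciT i k * gT j t
                  - ricciT j t * gT i k + ricciT i t * gT j k).

End Tables.

Local Ltac unfold_tables :=
  rewrite ?/riemT ?/ricciT /riem_upT /sumT /dchrisT /chrisT /chrT ?/gT /=.

Section WeylWalker.
Variables (O : set (@pt R)) (a b c : @pt R -> R) (x : @pt R).
Hypotheses (oO : open O) (ia : ignores34 a) (ib : ignores34 b) (ic : ignores34 c).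
Hypotheses (sa : smooth_on O a) (sb : smooth_on O b) (sc : smooth_on O c).
Hypothesis Ox : O x.
Notation W := (walker a b c).

Lemma riem_up_walker l i j k : riem_up W l i j k x =
  riem_upT (jet_at a x) (jet_at b x) (jet_at c x) l i j k.
Proof.
rewrite /riem_up /riem_upT sum4 /sumT; congr (_ - _ + _).
- exact: (pd_christoffel_walker oO ia ib ic sa sb sc i l j k Ox).
- exact: (pd_christoffel_walker oO ia ib ic sa sb sc j l i k Ox).
- by congr (_ * _ - _ * _ + (_ * _ - _ * _) + (_ * _ - _ * _) + (_ * _ - _ * _));
    exact: christoffel_walker.
Qed.

Lemma riem_walker i j k t : riem W i j k t x =
  riemT (jet_at a x) (jet_at b x) (jet_at c x) i j k t.
Proof.
rewrite /riem /riemT sum4 /sumT.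
by congr (_ * _ + _ * _ + _ * _ + _ * _); exact: riem_up_walker.
Qed.

Lemma ricci_walker j k : ricci W j k x =
  ricciT (jet_at a x) (jet_at b x) (jet_at c x) j k.
Proof.
by rewrite /ricci /ricciT sum4 /sumT; congr (_ + _ + _ + _); exact: riem_up_walker.
Qed.

Lemma scal_walker : scal W x = scalT (jet_at a x) (jet_at b x) (jet_at c x).
Proof.
have E i : \sum_(j < 4) ginv W x i j * ricci W i j x = sumT (fun j =>
    ginvT (jet_at a x) (jet_at b x) (jet_at c x) i j *
    ricciT (jet_at a x) (jet_at b x) (jet_at c x) i j).
  rewrite sum4 /sumT.
  by congr (_ * _ + _ * _ + _ * _ + _ * _);
    do 1?[exact: ricci_walker]; exact: ginv_walker.
by rewrite /scal /scalT sum4; congr (_ + _ + _ + _); exact: E.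
Qed.

Lemma weyl_walker i j k t : weyl W i j k t x =
  weylT (jet_at a x) (jet_at b x) (jet_at c x) i j k t.
Proof.
rewrite /weyl /weylT riem_walker scal_walker.
(* The metric entries agree by computation, so only the Ricci entries remain. *)
by congr (_ + _ - _ * (_ * _ - _ * _ - _ * _ + _ * _)); exact: ricci_walker.
Qed.

End WeylWalker.

(** * Vanishing of the Weyl tensor as conditions on jets *)

Section WeylAlgebra.
Variables a a1 a2 a11 a12 a22 b b1 b2 b11 b12 b22 c c1 c2 c11 c12 c22 : R.
Let A := Jet a a1 a2 a11 a12 a22.
Let B := Jet b b1 b2 b11 b12 b22.
Let C := Jet c c1 c2 c11 c12 c22.

(** The Ricci tensor in simplified form, so that later computations expand only the Riemann part of
    the Weyl tensor. *)
Definition ricciS (j k : nat) : R :=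
  match j, k with
  | 0, 2 | 2, 0 => ((a11 + c12) / 2)%R
  | 0, 3 | 3, 0 => ((b12 + c11) / 2)%R
  | 1, 2 | 2, 1 => ((a12 + c22) / 2)%R
  | 1, 3 | 3, 1 => ((b22 + c12) / 2)%R
  | 2, 2 => ((a * a11 + a1 * c2 + a2 * b2 - a2 * c1 + a22 * b - c2 * c2) / 2
             + a12 * c)%R
  | 2, 3 | 3, 2 => ((a * c11 - a2 * b1 + b * c22 + c1 * c2) / 2 + c * c12)%R
  | 3, 3 => ((a * b11 + a1 * b1 + b * b22 - b1 * c2 + b2 * c1 - c1 * c1) / 2
             + b12 * c)%R
  | _, _ => 0%R
  end%N.

Lemma ricciTE j k : (j < 4)%N -> (k < 4)%N -> ricciT A B C j k = ricciS j k.
Proof.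
by case: j k => [|[|[|[|//]]]] [|[|[|[|//]]]] _ _; unfold_tables; num_field.
Qed.

Lemma scalTE : scalT A B C = a11 + b22 + 2 * c12.
Proof. by rewrite /scalT /sumT !ricciTE//= /ginvT /=; num_field. Qed.

Lemma weylTE i j k t : (i < 4)%N -> (j < 4)%N -> (k < 4)%N -> (t < 4)%N ->
  weylT A B C i j k t = riemT A B C i j k t
  + (a11 + b22 + 2 * c12) / 6
    * (gT A B C j k * gT A B C i t - gT A B C i k * gT A B C j t)
  - (ricciS j k * gT A B C i t - ricciS i k * gT A B C j t
     - ricciS j t * gT A B C i k + ricciS i t * gT A B C j k) / 2.
Proof. by move=> i4 j4 k4 t4; rewrite /weylT scalTE !ricciTE//; num_field. Qed.

(* Minus the determinant with rows [(a, b, c)], [(a1, b1, c1)], [(a2, b2, c2)]. *)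
Definition wronskian := a * (b2 * c1 - b1 * c2) + b * (a1 * c2 - a2 * c1)
  + c * (a2 * b1 - a1 * b2).

(** Each condition is read off one component. The six second-order ones come first; substituting
    them simplifies the components that give the last two. *)
Lemma weylT_eq0 :
  (forall i j k t, (i < 4)%N -> (j < 4)%N -> (k < 4)%N -> (t < 4)%N ->
     weylT A B C i j k t = 0) ->
  [/\ a22 = 0, b11 = 0, c12 = 0, b22 = - a11 & [/\ b12 = c11, a12 = c22,
     b * a12 - a * b12 + c * a11 = 0 & wronskian = 0]].
Proof.
move=> w0.
have w i j k t i4 j4 k4 t4 :=
  etrans (esym (@weylTE i j k t i4 j4 k4 t4)) (w0 i j k t i4 j4 k4 t4).
have Ea22 : a22 = 0.
  move: (w 1 2 1 2 isT isT isT isT)%N; unfold_tables; lra.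
have Eb11 : b11 = 0.
  move: (w 0 3 0 3 isT isT isT isT)%N; unfold_tables; lra.
have Ec12 : c12 = 0.
  move: (w 0 2 1 3 isT isT isT isT)%N; unfold_tables; lra.
have Eb22 : b22 = - a11.
  move: (w 0 1 2 3 isT isT isT isT)%N; rewrite Ec12.
  unfold_tables; lra.
have Eb12 : b12 = c11.
  move: (w 0 2 0 3 isT isT isT isT)%N; unfold_tables; lra.
have Ea12 : a12 = c22.
  move: (w 0 2 1 2 isT isT isT isT)%N; unfold_tables; lra.
have Ek : b * a12 - a * b12 + c * a11 = 0.
  move: (w 0 2 2 3 isT isT isT isT)%N.
  unfold_tables.
  rewrite Ec12 Eb22 Eb12 Ea12; lra.
split => //; split => //.
move: (w 2 3 2 3 isT isT isT isT)%N.
rewrite /wronskian; unfold_tables.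
rewrite Ea22 Eb11 Ec12 Eb22 Eb12 Ea12; lra.
Qed.

End WeylAlgebra.

Lemma weylT_antisym (A B C : jet) i j k t :
  weylT A B C j i k t = - weylT A B C i j k t.
Proof.
by rewrite /weylT /riemT /riem_upT /sumT; num_field.
Qed.

(** The six second-order conditions are built into the shape of the jets; each component then
    vanishes by linear arithmetic from the two remaining equations. *)
Lemma weylT_flat (a a1 a2 b b1 b2 c c1 c2 p q r : R) i j k t :
  let A := Jet a a1 a2 p q 0 in let B := Jet b b1 b2 0 r (- p) in
  let C := Jet c c1 c2 r 0 q in
  b * q - a * r + c * p = 0 -> wronskian a a1 a2 b b1 b2 c c1 c2 = 0 ->
  (i < 4)%N -> (j < 4)%N -> (k < 4)%N -> (t < 4)%N -> weylT A B C i j k t = 0.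
Proof.
move=> A B C; rewrite /wronskian => H1 H2 i4 j4 k4 t4.
(* Antisymmetry exchanges the first two indices, and for equal ones it makes the component its own
   opposite. *)
wlog ij : i j i4 j4 / (i < j)%N.
  move=> H; have [ij|ji|ij] := ltngtP i j; first exact: (H i j i4 j4 ij).
    by rewrite weylT_antisym (H j i j4 i4 ji) oppr0.
  by have := weylT_antisym A B C i i k t; rewrite ij; lra.
rewrite /A /B /C weylTE//; move: i j k t i4 j4 k4 t4 ij.
case=> [|[|[|[|//]]]] [|[|[|[|//]]]] [|[|[|[|//]]]] [|[|[|[|//]]]] _ _ _ _ // _;
  unfold_tables; lra.
Qed.

End CurvatureTable.

(** * Conformally flat Walker metrics *)

(** The hypotheses are relations between the linear and constant coefficients of [a], [b], [c]. If
    [M], [E] or [I] is nonzero, dividing by it eliminates the coefficients of [a], [b] or [c]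
    respectively. If all three vanish, the functions are affine and their linear parts cancel
    against the derivative rows. *)
Lemma wronskian_cst (R : realType) (E F G I J K L M N P C T u v : R) :
  E * N - J * M + I * P = 0 -> E * L - F * M + I * G = 0 ->
  E * T - K * M + I * C = 0 ->
  wronskian
    (I / 2 * u ^+ 2 + E * (u * v) + 0 / 2 * v ^+ 2 + J * u + F * v + K)
    (I * u + E * v + J) (E * u + 0 * v + F)
    (0 / 2 * u ^+ 2 + M * (u * v) + - I / 2 * v ^+ 2 + N * u + L * v + T)
    (0 * u + M * v + N) (M * u + - I * v + L)
    (M / 2 * u ^+ 2 + 0 * (u * v) + E / 2 * v ^+ 2 + P * u + G * v + C)
    (M * u + 0 * v + P) (0 * u + E * v + G)
  = K * (L * P - N * G) + T * (J * G - F * P) + C * (F * N - J * L).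
Proof.
rewrite /wronskian => H1 H2 H3.
have [M0|M0] := eqVneq M 0; last first.
  have -> : J = (E * N + I * P) / M by apply/(mulIf M0); rewrite mulfVK//; lra.
  have -> : F = (E * L + I * G) / M by apply/(mulIf M0); rewrite mulfVK//; lra.
  have -> : K = (E * T + I * C) / M by apply/(mulIf M0); rewrite mulfVK//; lra.
  by field; rewrite ?M0 ?pnatr_eq0.
have [E0|E0] := eqVneq E 0; last first.
  have -> : N = (J * M - I * P) / E by apply/(mulIf E0); rewrite mulfVK//; lra.
  have -> : L = (F * M - I * G) / E by apply/(mulIf E0); rewrite mulfVK//; lra.
  have -> : T = (K * M - I * C) / E by apply/(mulIf E0); rewrite mulfVK//; lra.
  by field; rewrite ?E0 ?pnatr_eq0.
rewrite M0 E0; rewrite M0 E0 in H1 H2 H3.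
have [I0|I0] := eqVneq I 0; first by rewrite I0; num_field.
have -> : P = 0 by apply: (mulfI I0); lra.
have -> : G = 0 by apply: (mulfI I0); lra.
have -> : C = 0 by apply: (mulfI I0); lra.
by num_field.
Qed.

Section FlatWalker.
Context {R : realType}.
Implicit Types (O : set (@pt R)) (f g : @pt R -> R) (x : @pt R).

Lemma jet_quad O f p q r s t k x : open O ->
  (forall y, O y -> f y = quad p q r s t k y) -> O x ->
  jet_at f x = Jet (p / 2 * x 0 0 ^+ 2 + q * (x 0 0 * x 0 1) + r / 2 * x 0 1 ^+ 2
    + s * x 0 0 + t * x 0 1 + k)
    (p * x 0 0 + q * x 0 1 + s) (q * x 0 0 + r * x 0 1 + t) p q r.
Proof.
move=> oO fq Ox; have E0 y : O y -> pd 0 f y = quad 0 0 0 p q s y.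
  by move=> Oy; rewrite (pd_congr 0 oO fq Oy) pd_quad0.
have E1 y : O y -> pd 1 f y = quad 0 0 0 q r t y.
  by move=> Oy; rewrite (pd_congr 1 oO fq Oy) pd_quad1.
rewrite /jet_at fq// E0// E1// (pd_congr 0 oO E0 Ox) (pd_congr 1 oO E0 Ox)
  (pd_congr 1 oO E1 Ox) pd_quad0 !pd_quad1.
by congr Jet; rewrite /quad; num_field.
Qed.

(** Differentiating the identity on the open set isolates [s] and [t]; evaluation at one point then
    gives [k]. *)
Lemma affine_eq0 O s t k : open O -> O !=set0 ->
  (forall x, O x -> quad 0 0 0 s t k x = 0) -> [/\ s = 0, t = 0 & k = 0].
Proof.
move=> oO [x Ox] H.
have Ev (k' : R) (y : @pt R) : quad 0 0 0 0 0 k' y = k' by rewrite /quad; num_field.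
have s0 : s = 0.
  by rewrite -(Ev s x) -(pd_quad0 0 0 0 s t k) (pd_congr 0 oO H Ox) pd_cst.
have t0 : t = 0.
  by rewrite -(Ev t x) -(pd_quad1 0 0 0 s t k) (pd_congr 1 oO H Ox) pd_cst.
by split=> //; rewrite -(Ev k x) -[RHS](H x Ox) s0 t0.
Qed.

Lemma pd_eq0 O f i : open O -> (forall x, O x -> f x = 0) ->
  forall x, O x -> pd i f x = 0.
Proof. by move=> oO f0 x Ox; rewrite (pd_congr i oO f0 Ox) pd_cst. Qed.

Lemma pd0_cst O f : open O -> connected O -> smooth_on O f -> ignores34 f ->
  (forall x, O x -> pd 0 f x = 0) -> (forall x, O x -> pd 1 f x = 0) ->
  exists k, forall x, O x -> f x = k.
Proof.
move=> oO cO sf ff f0 f1.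
have [|||||k H] := @gradient_eq_cst _ O f (fun=> 0) oO cO _ _ ff.
- by move=> x Ox; exact: smooth_differentiable sf Ox.
- by move=> x _; exact: differentiable_cst.
- by [].
- by move=> x Ox; rewrite pd_cst f0.
- by move=> x Ox; rewrite pd_cst f1.
by exists k => x Ox; rewrite H// add0r.
Qed.

(* The second-order equations form a closed system: differentiating once more
   and commuting derivatives kills every third derivative. *)
Lemma flat_hessian_quad O (a b c : @pt R -> R) : open O -> connected O ->
  smooth_on O a -> smooth_on O b -> smooth_on O c ->
  ignores34 a -> ignores34 b -> ignores34 c ->
  (forall x, O x -> pd 1 (pd 1 a) x = 0) ->
  (forall x, O x -> pd 0 (pd 0 b) x = 0) ->
  (forall x, O x -> pd 1 (pd 0 c) x = 0) ->
  (forall x, O x -> pd 1 (pd 1 b) x = - pd 0 (pd 0 a) x) ->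
  (forall x, O x -> pd 1 (pd 0 b) x = pd 0 (pd 0 c) x) ->
  (forall x, O x -> pd 1 (pd 0 a) x = pd 1 (pd 1 c) x) ->
  exists I E M, [/\
    exists s t k, forall x, O x -> a x = quad I E 0 s t k x,
    exists s t k, forall x, O x -> b x = quad 0 M (- I) s t k x &
    exists s t k, forall x, O x -> c x = quad M 0 E s t k x].
Proof.
move=> oO cO sa sb sc ia ib ic a22 b11 c12 ba bc ac.
have C f i j : smooth_on O f -> forall x, O x -> pd i (pd j f) x = pd j (pd i f) x.
  by move=> sf x; exact: pdC.
have cong f g i := @pd_congr _ O f g i oO.
have zero f i := @pd_eq0 O f i oO.
have s2 f i j : smooth_on O f -> smooth_on O (pd i (pd j f)).
  by move=> sf; do 2!apply: smooth_pd.
have i2 f i j : ignores34 f -> ignores34 (pd i (pd j f)).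
  by move=> ff; do 2!apply: ignores34_pd.
have c21 x : O x -> pd 0 (pd 1 c) x = 0 by move=> Ox; rewrite C// c12.
have c112 x : O x -> pd 1 (pd 0 (pd 0 c)) x = 0.
  by move=> Ox; rewrite (C _ _ _ (smooth_pd 0 sc) _ Ox); exact: zero.
have c221 x : O x -> pd 0 (pd 1 (pd 1 c)) x = 0.
  by move=> Ox; rewrite (C _ _ _ (smooth_pd 1 sc) _ Ox); exact: zero.
have ba' x : O x -> pd 0 (pd 0 a) x = - pd 1 (pd 1 b) x.
  by move=> Ox; rewrite ba// opprK.
have [||I HI] := pd0_cst oO cO (s2 a 0 0 sa) (i2 a 0 0 ia).
(* With subscripts for [u_1] and [u_2]: a_111 = - b_122 = - c_112 = 0. *)
- move=> x Ox; rewrite (cong _ (- pd 1 (pd 1 b)) _ ba' _ Ox).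
  rewrite /pd deriveN; last first.
    exact: diff_derivable (smooth_differentiable (s2 b 1 1 sb) Ox).
  apply/eqP; rewrite oppr_eq0; apply/eqP.
  apply: etrans (C _ 0 1 (smooth_pd 1 sb) _ Ox) _.
  rewrite -(c112 _ Ox); apply: cong Ox => y Oy.
  by rewrite (C _ _ _ sb _ Oy) bc.
(* a_112 = c_122 = 0. *)
- move=> x Ox; rewrite (C _ _ _ (smooth_pd 0 sa) _ Ox) -(c221 _ Ox).
  exact: cong Ox.
have [||E HE] := pd0_cst oO cO (s2 a 1 0 sa) (i2 a 1 0 ia).
- by move=> x Ox; rewrite -(c221 _ Ox); exact: cong Ox.
(* a_122 = 0, as the derivative of a_22. *)
- move=> x Ox; rewrite (cong _ (pd 0 (pd 1 a)) _ _ _ Ox); last exact: C.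
  by rewrite (C _ _ _ (smooth_pd 1 sa) _ Ox); exact: zero.
have [||M HM] := pd0_cst oO cO (s2 c 0 0 sc) (i2 c 0 0 ic).
(* c_111 = b_112 = 0, since b_11 vanishes. *)
- move=> x Ox; rewrite (cong _ (pd 1 (pd 0 b)) _ _ _ Ox); last first.
    by move=> y Oy; rewrite bc.
  by rewrite (C _ _ _ (smooth_pd 0 sb) _ Ox); exact: zero.
- exact: c112.
exists I, E, M; split.
- exact: (hessian_cst_quad oO cO sa ia HI HE a22).
- apply: (hessian_cst_quad oO cO sb ib b11) => x Ox.
  + by rewrite bc// HM.
  + by rewrite ba// HI.
- apply: (hessian_cst_quad oO cO sc ic HM c12) => x Ox.
  by rewrite -ac// HE.
Qed.

End FlatWalker.

(** * The equivalence with the explicit quadratic family *)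

Unset Implicit Arguments. Set Strict Implicit.

Theorem theorem5p1 (R : realType) (O : set 'rV[R]_4) (a b c : R -> R -> R) :
  open O -> connected O ->
  smooth_on O (of12 a) -> smooth_on O (of12 b) -> smooth_on O (of12 c) ->
  (locally_conformally_flat O (walker (of12 a) (of12 b) (of12 c)) <->
   exists E F G H I J K L M N P Q Rc : R,
     (forall x : 'rV[R]_4, O x ->
        a (x 0 0) (x 0 1) = I / 2 * (x 0 0) ^+ 2 + J * x 0 0
                            + E * x 0 0 * x 0 1 + F * x 0 1 + K /\
        b (x 0 0) (x 0 1) = - (I / 2) * (x 0 1) ^+ 2 + L * x 0 1
                            + M * x 0 0 * x 0 1 + N * x 0 0 + Rc /\
        c (x 0 0) (x 0 1) = M / 2 * (x 0 0) ^+ 2 + P * x 0 0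
                            + E / 2 * (x 0 1) ^+ 2 + G * x 0 1 + (Q + H)) /\
     0 = E * N - J * M + I * P /\
     0 = E * L - F * M + I * G /\
     0 = E * Rc - K * M + I * (H + Q) /\
     0 = K * (L * P - N * G) + Rc * (J * G - F * P) + (Q + H) * (F * N - J * L)).
Proof.
move=> oO cO sa sb sc.
have ia := ignores34_of12 a; have ib := ignores34_of12 b.
have ic := ignores34_of12 c.
have WE x i j k t (Ox : O x) := weyl_walker oO ia ib ic sa sb sc Ox i j k t.
split=> [flat|]; last first.
  move=> [E [F [G [H [I [J [K [L [M [N [P [Q [T [abc [H1 [H2 [H3 H4]]]]]]]]]]]]]]]]].
  move=> x Ox i j k t; rewrite WE//.
  have qa y : O y -> of12 a y = quad I E 0 J F K y.
    by move=> /abc[+ _]; rewrite /of12 /quad => ->; num_field.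
  have qb y : O y -> of12 b y = quad 0 M (- I) N L T y.
    by move=> /abc[_ [+ _]]; rewrite /of12 /quad => ->; num_field.
  have qc y : O y -> of12 c y = quad M 0 E P G (Q + H) y.
    by move=> /abc[_ [_ +]]; rewrite /of12 /quad => ->; num_field.
  rewrite (addrC H) in H3.
  rewrite (jet_quad oO qa Ox) (jet_quad oO qb Ox) (jet_quad oO qc Ox).
  apply: weylT_flat => //.
    (* The quadratic terms of b a_12 - a b_12 + c a_11 cancel, leaving an affine function whose
       coefficients are the first three conditions. *)
    transitivity ((E * N - J * M + I * P) * x 0 0 + (E * L - F * M + I * G) * x 0 1
      + (E * T - K * M + I * (Q + H))); first by num_field.
    by rewrite -H1 -H2 -H3 !mul0r !addr0.
  by rewrite (wronskian_cst _ _ (esym H1) (esym H2) (esym H3)) -H4.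
(* On the empty set flatness gives no information, and zero constants satisfy the four equations. *)
have [-> | /set0P[x0 Ox0]] := eqVneq O set0.
  do 13!exists 0; split; first by move=> x [].
  by split; [|split; [|split]]; ring.
have W0 x (Ox : O x) i j k t (i4 : (i < 4)%N) (j4 : (j < 4)%N) (k4 : (k < 4)%N)
    (t4 : (t < 4)%N) :
    weylT (jet_at (of12 a) x) (jet_at (of12 b) x) (jet_at (of12 c) x) i j k t = 0.
  rewrite -(flat x Ox (Ordinal i4) (Ordinal j4) (Ordinal k4) (Ordinal t4)).
  exact: esym (WE x (Ordinal i4) (Ordinal j4) (Ordinal k4) (Ordinal t4) Ox).
have [I [E [M [[J [F [K qa]]] [N [L [T qb]]] [P [G [C qc]]]]]]] :
  exists I E M, [/\
    exists s t k, forall x, O x -> of12 a x = quad I E 0 s t k x,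
    exists s t k, forall x, O x -> of12 b x = quad 0 M (- I) s t k x &
    exists s t k, forall x, O x -> of12 c x = quad M 0 E s t k x].
  apply: (flat_hessian_quad oO cO sa sb sc ia ib ic) => x Ox;
  have [e1 e2 e3 e4 [e5 e6 _ _]] := weylT_eq0 (W0 x Ox);
  [exact: e1|exact: e2|exact: e3|exact: e4|exact: e5|exact: e6].
(* The same affine function now vanishes on a nonempty open set, so its coefficients are zero. *)
have [||H1 H2 H3] := @affine_eq0 _ O (E * N - J * M + I * P)
   (E * L - F * M + I * G) (E * T - K * M + I * C) oO.
- by exists x0.
- move=> x Ox; move: (W0 x Ox).
  rewrite (jet_quad oO qa Ox) (jet_quad oO qb Ox) (jet_quad oO qc Ox).
  move=> /weylT_eq0[_ _ _ _ [_ _ Hx _]]; apply: etrans Hx.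
  by rewrite /quad; num_field.
(* Only the sum of [H] and [Q] occurs, so [H = 0] and [Q = C] are chosen. *)
exists E, F, G, 0, I, J, K, L, M, N, P, C, T; rewrite add0r addr0.
split; last first.
  do 3!split => //.
  (* The determinant is constant, so its vanishing at the single point [x0] gives the fourth
     condition. *)
  move: (W0 x0 Ox0).
  rewrite (jet_quad oO qa Ox0) (jet_quad oO qb Ox0) (jet_quad oO qc Ox0).
  by move=> /weylT_eq0[_ _ _ _ [_ _ _]]; rewrite wronskian_cst.
move=> x Ox; have := qa x Ox; have := qb x Ox; have := qc x Ox.
rewrite /of12 /quad => -> -> ->.
by split; [|split]; num_field.
Qed.
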